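(* Consider the cyber-physical descriptor system $E\dot x(t)=Ax(t)+Bu(t)$, $y(t)=Cx(t)+Du(t)$, with $E,A\in\mathbb{R}^{n\times n}$, $C\in\mathbb{R}^{p\times n}$, $B=[I_n\;\,0]\in\mathbb{R}^{n\times(n+p)}$, $D=[0\;\,I_p]\in\mathbb{R}^{p\times(n+p)}$, and let $K\subseteq\{1,\dots,n+p\}$ be an attack set. The following statements are equivalent: (i) the attack set $K$ is unidentifiable by a dynamic monitor; (ii) there exists an attack set $R$, with $|R|\le|K|$ and $R\neq K$, and attack modes $u_K(t)$, $u_R(t)$ satisfying, for some $x(0)$ and for every $t\in\mathbb{R}_{\ge0}$, $$E\dot x(t)=Ax(t)+B_Ku_K(t)+B_Ru_R(t),\qquad 0=Cx(t)+D_Ku_K(t)+D_Ru_R(t);$$ (iii) there exists an attack set $R$, with $|R|\le|K|$ and $R\neq K$, $s\in\mathbb{C}$, $g_K\in\mathbb{C}^{|K|}$, $g_R\in\mathbb{C}^{|R|}$, and $x\in\mathbb{C}^n$, with $x\ne0$, such that $(sE-A)x-B_Kg_K-B_Rg_R=0$ and $Cx+D_Kg_K+D_Rg_R=0$. Moreover, there exists an attack set $K$, with $|K|=k\in\mathbb{N}_0$, unidentifiable by a dynamic monitor if and only if there exists an attack set $\bar K$, with $|\bar K|\le2k$, which is undetectable by a dynamic monitor.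
   Context: Standing assumptions: $E$ may be singular; the pair $(E,A)$ is regular, i.e. $\det(sE-A)$ does not vanish identically in $s$; the initial condition $x(0)$ is consistent, i.e. $Ax(0)+Bu(0)\perp\ker(E^{\mathsf T})$; the input $u$ is smooth. Attacks: $u(t)\in\mathbb{R}^{n+p}$ is an unknown attack signal. For an attack set $K\subseteq\{1,\dots,n+p\}$, only and all the entries of $u$ indexed by $K$ are nonzero over time (the component $u_i$ is not the identically zero signal exactly when $i\in K$). The attack mode $u_K(t)$ is the subvector of $u(t)$ indexed by $K$, and $B_K$, $D_K$ are the submatrices of $B$, $D$ formed by the columns indexed by $K$, so $Bu=B_Ku_K$ and $Du=D_Ku_K$. The pair $(B_Ku_K,D_Ku_K)$ is called an attack. A dynamic monitor is deterministic and knows $E,A,C$ and $y(t)$ for all $t\in\mathbb{R}_{\ge0}$. Let $y(x_0,u,t)$ be the output generated from initial state $x_0$ under the attack signal $u$. Dynamic undetectability: an attack $(B_Ku_K,D_Ku_K)$ is undetectable by a dynamic monitor if and only if $y(x_1,u_K,t)=y(x_2,0,t)$ for all $t\in\mathbb{R}_{\ge0}$, for some initial conditions $x_1,x_2\in\mathbb{R}^n$. Dynamic unidentifiability: an attack $(B_Ku_K,D_Ku_K)$ is unidentifiable by a dynamic monitor if and only if $y(x_1,u_K,t)=y(x_2,u_R,t)$ for all $t\in\mathbb{R}_{\ge0}$, for some initial conditions $x_1,x_2\in\mathbb{R}^n$ and some attack $(B_Ru_R,D_Ru_R)$ with $|R|\le|K|$ and $R\ne K$. An attack set $K$ is undetectable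 (respectively unidentifiable) by a dynamic monitor if there exists an attack with attack set $K$ that is undetectable (respectively unidentifiable) by a dynamic monitor.
   Formalization: (iii)⇒(i) is proved only if all entries of g_K, g_R are nonzero (false otherwise); (iii) as stated is proved equivalent to (i),(ii) with modes allowed zero entries and distinct initial states (x(0)≠0 in (ii)). In the last claim K̄ is nonempty and k≤n+p. *)

(* Defs.v *)
(* MathComp-Analysis; the real numbers are an arbitrary R : realType and the
   complex numbers are R[i]. *)
From HB Require Import structures.
From mathcomp Require Import all_boot all_order all_algebra.
From mathcomp Require Import all_classical all_reals all_analysis.
From mathcomp Require Export complex.

Set Implicit Arguments.
Unset Strict Implicit.
Unset Printing Implicit Defensive.

Import Order.TTheory GRing.Theory Num.Theory.
Import numFieldNormedType.Exports.

Local Open Scope classical_set_scope.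
Local Open Scope ring_scope.

(** * Signals

    Signals on the half-line [t >= 0] are represented by functions on [R] whose
    values at negative times are never constrained by the dynamics.  Smooth
    functions and differentiable functions on the half-line (one-sided
    derivatives at 0) all extend to [R], so two-sided derivatives at 0 lose
    nothing. *)

Definition time_derivative (R : realType) (m : nat) (f : R -> 'cV[R]_m) (t : R)
  : 'cV[R]_m := \col_i derive1 (fun s : R => f s i 0) t.

Definition smooth_signal (R : realType) (m : nat) (f : R -> 'cV[R]_m) : Prop :=
  forall (i : 'I_m) (k : nat) (t : R),
    derivable (derive1n k (fun s : R => f s i 0)) t 1.

(** * The descriptor system [E x' = A x + B u, y = C x + D u] *)

Definition input_mx (R : realType) (n p : nat) : 'M[R]_(n, n + p) :=
  row_mx 1%:M 0.

Definition feedthrough_mx (R : realType) (n p : nat) : 'M[R]_(p, n + p) :=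
  row_mx 0 1%:M.

(** Submatrix formed by the columns indexed by [K], in increasing order. *)
Definition colset (F : Type) (r m : nat) (M : 'M[F]_(r, m)) (K : {set 'I_m})
  : 'M[F]_(r, #|K|) := colsub (fun j : 'I_#|K| => enum_val j) M.

Definition BK (R : realType) (n p : nat) (K : {set 'I_(n + p)})
  : 'M[R]_(n, #|K|) := colset (input_mx R n p) K.

Definition DK (R : realType) (n p : nat) (K : {set 'I_(n + p)})
  : 'M[R]_(p, #|K|) := colset (feedthrough_mx R n p) K.

Definition cmx (R : realType) (r m : nat) (M : 'M[R]_(r, m)) : 'M[R[i]]_(r, m) :=
  map_mx (real_complex R) M.

Definition regular_pencil (R : realType) (n : nat) (E A : 'M[R]_n) : Prop :=
  exists s : R[i], \det (s *: cmx E - cmx A) != 0.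

(** [A x0 + b0] is orthogonal to the kernel of [E^T]. *)
Definition consistent (R : realType) (n : nat) (E A : 'M[R]_n)
    (x0 b0 : 'cV[R]_n) : Prop :=
  forall v : 'cV[R]_n, E^T *m v = 0 -> v^T *m (A *m x0 + b0) = 0.

(** [x] is a state trajectory from [x0] when the term [B u] is the signal [b]. *)
Definition state_trajectory (R : realType) (n : nat) (E A : 'M[R]_n)
    (b : R -> 'cV[R]_n) (x0 : 'cV[R]_n) (x : R -> 'cV[R]_n) : Prop :=
  [/\ consistent E A x0 (b 0),
      x 0 = x0,
      forall t : R, 0 <= t -> forall i, derivable (fun s : R => x s i 0) t 1
    & forall t : R, 0 <= t -> E *m time_derivative x t = A *m x t + b t].

(** [y] is the output [y(x0, u, .)] on [t >= 0], where [b] is [B u] and [d] is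
    [D u].  For a regular pencil there is at most one such output. *)
Definition system_output (R : realType) (n p : nat) (E A : 'M[R]_n)
    (C : 'M[R]_(p, n)) (b : R -> 'cV[R]_n) (d : R -> 'cV[R]_p) (x0 : 'cV[R]_n)
    (y : R -> 'cV[R]_p) : Prop :=
  exists x : R -> 'cV[R]_n, state_trajectory E A b x0 x /\
    forall t : R, 0 <= t -> y t = C *m x t + d t.

(** * Attacks *)

(** Attack mode with attack set exactly [K]: only and all the entries indexed by
    [K] are nonzero signals on [t >= 0]. *)
Definition attack_mode (R : realType) (m : nat) (K : {set 'I_m})
    (uK : R -> 'cV[R]_#|K|) : Prop :=
  smooth_signal uK /\
  forall j : 'I_#|K|, exists t : R, 0 <= t /\ uK t j 0 != 0.

(** The output from [x0] when the attack mode on [K] is [uK]. *)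
Definition attacked_output (R : realType) (n p : nat) (E A : 'M[R]_n)
    (C : 'M[R]_(p, n)) (K : {set 'I_(n + p)}) (uK : R -> 'cV[R]_#|K|)
    (x0 : 'cV[R]_n) (y : R -> 'cV[R]_p) : Prop :=
  system_output E A C (fun t => BK R K *m uK t) (fun t => DK R K *m uK t) x0 y.

(** [y(x1, uK, t) = y(x2, uR, t)] for all [t >= 0]. *)
Definition same_output (R : realType) (n p : nat) (E A : 'M[R]_n)
    (C : 'M[R]_(p, n)) (K S : {set 'I_(n + p)})
    (uK : R -> 'cV[R]_#|K|) (uS : R -> 'cV[R]_#|S|) (x1 x2 : 'cV[R]_n) : Prop :=
  exists y1 y2 : R -> 'cV[R]_p,
    [/\ attacked_output E A C uK x1 y1, attacked_output E A C uS x2 y2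
      & forall t : R, 0 <= t -> y1 t = y2 t].

Definition undetectable_attack (R : realType) (n p : nat) (E A : 'M[R]_n)
    (C : 'M[R]_(p, n)) (K : {set 'I_(n + p)}) (uK : R -> 'cV[R]_#|K|) : Prop :=
  exists x1 x2 : 'cV[R]_n, @same_output R n p E A C K finset.set0 uK (fun=> 0) x1 x2.

Definition unidentifiable_attack (R : realType) (n p : nat) (E A : 'M[R]_n)
    (C : 'M[R]_(p, n)) (K : {set 'I_(n + p)}) (uK : R -> 'cV[R]_#|K|) : Prop :=
  exists (S : {set 'I_(n + p)}) (uS : R -> 'cV[R]_#|S|) (x1 x2 : 'cV[R]_n),
    [/\ (#|S| <= #|K|)%N, S != K, attack_mode uS
      & same_output E A C uK uS x1 x2].

Definition undetectable_set (R : realType) (n p : nat) (E A : 'M[R]_n)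
    (C : 'M[R]_(p, n)) (K : {set 'I_(n + p)}) : Prop :=
  exists uK : R -> 'cV[R]_#|K|, attack_mode uK /\ undetectable_attack E A C uK.

Definition unidentifiable_set (R : realType) (n p : nat) (E A : 'M[R]_n)
    (C : 'M[R]_(p, n)) (K : {set 'I_(n + p)}) : Prop :=
  exists uK : R -> 'cV[R]_#|K|, attack_mode uK /\ unidentifiable_attack E A C uK.

(** The trajectory [x] from [x0] keeps the output at zero under the attack modes
    [uK] and [uS] acting together. *)
Definition zeroing_trajectory (R : realType) (n p : nat) (E A : 'M[R]_n)
    (C : 'M[R]_(p, n)) (K S : {set 'I_(n + p)})
    (uK : R -> 'cV[R]_#|K|) (uS : R -> 'cV[R]_#|S|)
    (x0 : 'cV[R]_n) (x : R -> 'cV[R]_n) : Prop :=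
  state_trajectory E A (fun t => BK R K *m uK t + BK R S *m uS t) x0 x /\
  forall t : R, 0 <= t -> 0 = C *m x t + DK R K *m uK t + DK R S *m uS t.

Definition zeroing_modes (R : realType) (n p : nat) (E A : 'M[R]_n)
    (C : 'M[R]_(p, n)) (K : {set 'I_(n + p)}) : Prop :=
  exists (S : {set 'I_(n + p)}) (uK : R -> 'cV[R]_#|K|) (uS : R -> 'cV[R]_#|S|)
      (x0 : 'cV[R]_n) (x : R -> 'cV[R]_n),
    [/\ (#|S| <= #|K|)%N, S != K, attack_mode uK, attack_mode uS
      & zeroing_trajectory E A C uK uS x0 x].

(** [x <> 0] is an output-zeroing direction at the frequency [s] with input
    directions [gK] and [gS]. *)
Definition invariant_zero (R : realType) (n p : nat) (E A : 'M[R]_n)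
    (C : 'M[R]_(p, n)) (K S : {set 'I_(n + p)}) (s : R[i])
    (gK : 'cV[R[i]]_#|K|) (gS : 'cV[R[i]]_#|S|) (x : 'cV[R[i]]_n) : Prop :=
  [/\ x != 0,
      (s *: cmx E - cmx A) *m x - cmx (BK R K) *m gK - cmx (BK R S) *m gS = 0
    & cmx C *m x + cmx (DK R K) *m gK + cmx (DK R S) *m gS = 0].

Definition pencil_condition (R : realType) (n p : nat) (E A : 'M[R]_n)
    (C : 'M[R]_(p, n)) (K : {set 'I_(n + p)}) : Prop :=
  exists (S : {set 'I_(n + p)}) (s : R[i])
      (gK : 'cV[R[i]]_#|K|) (gS : 'cV[R[i]]_#|S|) (x : 'cV[R[i]]_n),
    [/\ (#|S| <= #|K|)%N, S != K & invariant_zero E A C s gK gS x].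

(** Same, all entries of the input directions being nonzero, as attack modes
    require. *)
Definition pencil_condition_full (R : realType) (n p : nat) (E A : 'M[R]_n)
    (C : 'M[R]_(p, n)) (K : {set 'I_(n + p)}) : Prop :=
  exists (S : {set 'I_(n + p)}) (s : R[i])
      (gK : 'cV[R[i]]_#|K|) (gS : 'cV[R[i]]_#|S|) (x : 'cV[R[i]]_n),
    [/\ (#|S| <= #|K|)%N /\ S != K, forall j, gK j 0 != 0,
        forall j, gS j 0 != 0 & invariant_zero E A C s gK gS x].

(** * Attacks supported in an attack set

    [pencil_condition] lets the entries of [gK] and [gS] vanish and only asks that
    the state be nonzero.  Its exact time-domain counterparts do the same: the
    attack modes are arbitrary smooth signals, possibly with identically zero
    entries, and the two initial states differ.  The difference matters: if
    [x1' = x2 + u1], [x2' = u2] and three sensors all measure [x1], then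
    [pencil_condition] holds for the set [K] of the first sensor alone (frequency
    0, [gK = 0], [S] the first state equation), although no attack mode that is
    nonzero on [K] is unidentifiable. *)

Definition unidentifiable_within (R : realType) (n p : nat) (E A : 'M[R]_n)
    (C : 'M[R]_(p, n)) (K : {set 'I_(n + p)}) : Prop :=
  exists (S : {set 'I_(n + p)}) (uK : R -> 'cV[R]_#|K|) (uS : R -> 'cV[R]_#|S|)
      (x1 x2 : 'cV[R]_n),
    [/\ (#|S| <= #|K|)%N /\ S != K, smooth_signal uK, smooth_signal uS,
        x1 != x2 & same_output E A C uK uS x1 x2].

Definition zeroing_modes_within (R : realType) (n p : nat) (E A : 'M[R]_n)
    (C : 'M[R]_(p, n)) (K : {set 'I_(n + p)}) : Prop :=
  exists (S : {set 'I_(n + p)}) (uK : R -> 'cV[R]_#|K|) (uS : R -> 'cV[R]_#|S|)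
      (x0 : 'cV[R]_n) (x : R -> 'cV[R]_n),
    [/\ (#|S| <= #|K|)%N /\ S != K, smooth_signal uK, smooth_signal uS,
        x0 != 0 & zeroing_trajectory E A C uK uS x0 x].

(* Main.v *)
Require Import Defs.
From HB Require Import structures.
From mathcomp Require Import all_boot all_order all_algebra.
From mathcomp Require Import all_classical all_reals all_analysis.
From mathcomp Require Import ring lra.
Set Implicit Arguments.
Unset Strict Implicit.
Unset Printing Implicit Defensive.
Import Order.TTheory GRing.Theory Num.Theory.
Import numFieldNormedType.Exports.
Local Open Scope classical_set_scope.
Local Open Scope ring_scope.

(** Subtracting two attacked trajectories with equal outputs gives a trajectory
    with zero output, driven by the difference of the attacks.  Conversely, a
    regular pencil has a solution for every smooth input, so a zero-output
    trajectory splits as such a difference: with [q = det (X E - A)] and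
    [P = adj (X E - A)], the signal [P(D) z] solves [E x' = A x + b] as soon as
    [q(D) z = b], and [q(D)] is onto the smooth functions because each real
    linear or quadratic factor of [q] is.

    Since [B] and [D] together form the identity matrix, a zero-output trajectory
    attacked in [L] is a function [x] satisfying the equations of index outside
    [L].  The linear span of its positions is stable under differentiation; a
    complex eigenvector of the resulting matrix is an invariant zero direction.
    In the other direction one takes real parts of exponential solutions.

    For the last part, the zero-output attack on [Kbar] is shared between two
    distinct sets of at most [k] indices that cover [Kbar]. *)

(** * Smooth real functions *)

Definition smooth (R : realType) (f : R -> R) : Prop :=
  forall k t, derivable (derive1n k f) t 1.

Section Smooth.
Variable R : realType.
Implicit Types (f g : R -> R) (a c t d : R).

Lemma is_derive1E f t d : is_derive t (1 : R) f d -> derive1 f t = d.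
Proof. by move=> H; rewrite derive1E derive_val. Qed.

Lemma derive1_fun f (df : R -> R) : (forall t, is_derive t (1 : R) f (df t)) -> derive1 f = df.
Proof. by move=> H; apply/funext => t; apply: is_derive1E. Qed.

Lemma smooth_derivable f t : smooth f -> derivable f t 1.
Proof. by move/(_ 0 t). Qed.

Lemma smooth_derive1 f : smooth f -> smooth (derive1 f).
Proof. by move=> sf k t; rewrite -derive1Sn. Qed.

Lemma smooth_continuous f : smooth f -> continuous f.
Proof.
by move=> sf t; apply/differentiable_continuous/derivable1_diffP/smooth_derivable.
Qed.

Lemma derive1_lin c f g : (forall t, derivable f t (1 : R)) -> (forall t, derivable g t (1 : R)) ->
  derive1 (c *: f + g) = c *: derive1 f + derive1 g.
Proof.
move=> df dg; apply/funext => t; rewrite fctE /= !derive1E.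
rewrite (@deriveD _ R R (c *: f) g)//; last exact: derivableZ.
by rewrite deriveZ// -!derive1E.
Qed.

(** Finite-order regularity ([m.+1] derivatives exist), the quantity on which smoothness is proved
    by induction. *)
Definition diffn (m : nat) f : Prop :=
  forall k t, (k <= m)%N -> derivable (derive1n k f) t (1 : R).

Lemma smooth_diffn m f : smooth f -> diffn m f.
Proof. by move=> sf k t _; exact: sf. Qed.

Lemma diffn_lin m c f g : diffn m f -> diffn m g -> diffn m (c *: f + g).
Proof.
elim: m f g => [|m IH] f g df dg k t km.
  move: km; rewrite leqn0 => /eqP ->.
  by apply: derivableD; [apply: derivableZ; exact: (df 0)|exact: (dg 0)].
case: k km => [_|k km].
  by apply: derivableD; [apply: derivableZ; exact: (df 0)|exact: (dg 0)].
rewrite derive1Sn derive1_lin; [|by move=> u; exact: (df 0)|by move=> u; exact: (dg 0)].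
apply: IH => // j u jm.
  by rewrite -derive1Sn; exact: df.
by rewrite -derive1Sn; exact: dg.
Qed.

Lemma smooth_lin c f g : smooth f -> smooth g -> smooth (c *: f + g).
Proof.
by move=> sf sg k t;
  exact: (@diffn_lin k _ _ _ (@smooth_diffn k f sf) (@smooth_diffn k g sg) k t (leqnn k)).
Qed.

(** Bootstrapping: the derivatives of [z] and [w] are linear combinations of [z], [w] and smooth
    functions, so each order of differentiability yields the next. *)
Lemma smooth_planar_system (a b c d : R) (z w f g : R -> R) :
  smooth f -> smooth g ->
  (forall t, is_derive t (1 : R) z (a * z t + (b * w t + f t))) ->
  (forall t, is_derive t (1 : R) w (c * z t + (d * w t + g t))) ->
  smooth z /\ smooth w.
Proof.
move=> sf sg dz dw.
have ez : derive1 z = a *: z + (b *: w + f) by exact: derive1_fun.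
have ew : derive1 w = c *: z + (d *: w + g) by exact: derive1_fun.
suff H m : diffn m z /\ diffn m w.
  by split=> k t; [apply: (H k).1|apply: (H k).2].
elim: m => [|m [IHz IHw]].
  by split=> k t; rewrite leqn0 => /eqP ->; [have [] := dz t|have [] := dw t].
split=> -[|k] t km; rewrite ?derive1Sn ?ez ?ew.
- by have [] := dz t.
- exact: (@diffn_lin m _ _ _ IHz (@diffn_lin m _ _ _ IHw (@smooth_diffn m f sf)) k t km).
- by have [] := dw t.
- exact: (@diffn_lin m _ _ _ IHz (@diffn_lin m _ _ _ IHw (@smooth_diffn m g sg)) k t km).
Qed.

Lemma smooth0 : smooth (0 : R -> R).
Proof.
move=> k t; have -> : derive1n k (0 : R -> R) = cst 0; last exact: derivable_cst.
elim: k => // k IH; rewrite derive1nS IH; apply: derive1_fun => u; exact: is_derive_cst.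
Qed.


Lemma exists_primitive f : continuous f -> exists F : R -> R, forall t, is_derive t (1 : R) F (f t).
Proof.
move=> cf.
have intf a b : (@lebesgue_measure R).-integrable `[a, b] (EFin \o f).
  by apply: continuous_compact_integrable; [exact: segment_compact|exact: continuous_subspaceT].
pose P a t := (\int[lebesgue_measure]_(s in `[a, t]) f s)%R.
pose Q a t := (\int[lebesgue_measure]_(s in `]a, t]) f s)%R.
have PQ a b t : a <= b -> b <= t -> P a t - P a b = Q b t.
  by move=> ab bt; apply: Rintegral_itvB; rewrite ?bnd_simp.
have Q0 a b : b <= a -> Q a b = 0.
  by move=> ba; rewrite /Q set_itv_ge ?Rintegral_set0// bnd_simp -leNgt.
(* The signed integral from [0] to [t]: one of the two terms vanishes, according to the sign of
   [t]. *)
exists (fun t => Q 0 t - Q t 0) => t.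
(* With a base point below both [0] and [t], the signed integral is near [t] the function [P N]
   minus the constant [P N 0], to which the fundamental theorem applies. *)
pose N : R := - (`|t| + 1).
have Nt : N < t by rewrite /N ltrNl; have := ler_norm (- t); rewrite normrN; lra.
have N0 : N <= 0 by rewrite /N; have := normr_ge0 t; lra.
have dP : is_derive t (1 : R) (P N) (f t).
  have [|||| dP eP] := @continuous_FTC1 R f (BLeft N) t (t + 1).
  - by rewrite ltrDl.
  - exact: intf.
  - by rewrite /= lte_fin; lra.
  - exact: cf.
  by split; [exact: dP | rewrite -derive1E; exact: eP].
have dPc : is_derive t (1 : R) (fun s => P N s - P N 0) (f t).
  rewrite -[f t]subr0; apply: is_deriveB.
apply: near_eq_is_derive dPc.
near=> s.
have Ns : N < s by near: s; exact: lt_nbhsr.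
have [s0|/ltW s0] := leP 0 s.
  by rewrite PQ// (Q0 s 0)// subr0.
by rewrite (Q0 0 s)// sub0r -(PQ N)// ?opprB// ltW.
Unshelve. all: by end_near. Qed.


Lemma is_derive_mull a t : is_derive t (1 : R) (fun s => a * s) a.
Proof.
have -> : (fun s => a * s) = a *: (id : R -> R) by [].
by apply: is_derive_eq; rewrite /GRing.scale /= mulr1.
Qed.

Lemma is_derive_expcos a b t :
  is_derive t (1 : R) (fun s => expR (a * s) * cos (b * s))
    (a * (expR (a * t) * cos (b * t)) - b * (expR (a * t) * sin (b * t))).
Proof.
have da := is_derive_mull a t; have db := is_derive_mull b t.
have de : is_derive t (1 : R) (fun s => expR (a * s)) (a * expR (a * t)).
  by rewrite mulrC; apply: (@is_derive1_comp R expR (fun s => a * s)).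
have dc : is_derive t (1 : R) (fun s => cos (b * s)) (- sin (b * t) * b).
  by apply: (@is_derive1_comp R cos (fun s => b * s)).
apply: is_derive_eq (is_deriveM de dc) _.
by rewrite /GRing.scale /=; ring.
Qed.

Lemma is_derive_expsin a b t :
  is_derive t (1 : R) (fun s => expR (a * s) * sin (b * s))
    (a * (expR (a * t) * sin (b * t)) + b * (expR (a * t) * cos (b * t))).
Proof.
have da := is_derive_mull a t; have db := is_derive_mull b t.
have de : is_derive t (1 : R) (fun s => expR (a * s)) (a * expR (a * t)).
  by rewrite mulrC; apply: (@is_derive1_comp R expR (fun s => a * s)).
have dc : is_derive t (1 : R) (fun s => sin (b * s)) (cos (b * t) * b).
  by apply: (@is_derive1_comp R sin (fun s => b * s)).
apply: is_derive_eq (is_deriveM de dc) _.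
by rewrite /GRing.scale /=; ring.
Qed.

(** The two functions solve a planar linear system without forcing. *)
Lemma smooth_exp_trig a b :
  smooth (fun s : R => expR (a * s) * cos (b * s)) /\
  smooth (fun s : R => expR (a * s) * sin (b * s)).
Proof.
have dc t : is_derive t (1 : R) (fun s => expR (a * s) * cos (b * s))
    (a * (expR (a * t) * cos (b * t)) + (- b * (expR (a * t) * sin (b * t)) + (0 : R -> R) t)).
  by apply: is_derive_eq (is_derive_expcos a b t) _; rewrite addr0 -mulNr.
have ds t : is_derive t (1 : R) (fun s => expR (a * s) * sin (b * s))
    (b * (expR (a * t) * cos (b * t)) + (a * (expR (a * t) * sin (b * t)) + (0 : R -> R) t)).
  by apply: is_derive_eq (is_derive_expsin a b t) _; rewrite addr0 addrC.
exact: (smooth_planar_system smooth0 smooth0 dc ds).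
Qed.

(** Variation of constants for the complex equation [h' = (a + i b) h + f] with [h = w + i z]: the
    function [P - i Q] is a primitive of [exp(-(a + i b) t) f], and [h] is its product with
    [exp((a + i b) t)]. *)
Lemma exists_smooth_spiral a b f : smooth f -> exists z w : R -> R,
  [/\ smooth z, smooth w,
    forall t, derive1 z t = a * z t + b * w t
  & forall t, derive1 w t = a * w t - b * z t + f t].
Proof.
move=> sf.
have cf := smooth_continuous sf.
have [cc cs] : continuous (fun s => expR (- a * s) * cos (b * s) : R) /\
  continuous (fun s => expR (- a * s) * sin (b * s) : R).
  split; first exact: smooth_continuous (smooth_exp_trig _ _).1.
  exact: smooth_continuous (smooth_exp_trig _ _).2.
have [P dP] := @exists_primitive (fun s => expR (- a * s) * cos (b * s) * f s)
  (fun t => continuousM (cc t) (cf t)).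
have [Q dQ] := @exists_primitive (fun s => expR (- a * s) * sin (b * s) * f s)
  (fun t => continuousM (cs t) (cf t)).
pose c s : R := expR (a * s) * cos (b * s).
pose e s : R := expR (a * s) * sin (b * s).
pose z := (e * P - c * Q)%R; pose w := (c * P + e * Q)%R.
have en t : expR (- a * t) * expR (a * t) = 1 by rewrite -expRD mulNr addNr expR0.
have cse t : cos (b * t) ^+ 2 + sin (b * t) ^+ 2 = 1 :> R by exact: cos2Dsin2.
have dz t : is_derive t (1 : R) z (a * z t + b * w t).
  apply: is_derive_eq (is_deriveB (is_deriveM (is_derive_expsin a b t) (dP t))
    (is_deriveM (is_derive_expcos a b t) (dQ t))) _.
  by rewrite /GRing.scale /= /z /w !fctE /c /e; ring.
have dw t : is_derive t (1 : R) w (a * w t - b * z t + f t).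
  apply: is_derive_eq (is_deriveD (is_deriveM (is_derive_expcos a b t) (dP t))
    (is_deriveM (is_derive_expsin a b t) (dQ t))) _.
  rewrite /GRing.scale /= /z /w !fctE /c /e.
  (* Factors equal to 1 are inserted so that the identity becomes polynomial and [ring] applies. *)
  have K : f t = expR (- a * t) * expR (a * t) * (cos (b * t) ^+ 2 + sin (b * t) ^+ 2) * f t.
    by rewrite en cse !mul1r.
  by rewrite [in RHS]K; ring.
have dz0 t : is_derive t (1 : R) z (a * z t + (b * w t + (0 : R -> R) t)).
  by apply: is_derive_eq (dz t) _; rewrite addr0.
have dw0 t : is_derive t (1 : R) w (- b * z t + (a * w t + f t)).
  by apply: is_derive_eq (dw t) _; rewrite addrA [- b * _ + _]addrC mulNr.
have [sz sw] := smooth_planar_system smooth0 sf dz0 dw0.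
by exists z, w; split=> // t; apply: is_derive1E.
Qed.

End Smooth.

(** * Constant-coefficient differential operators *)

Section PolyOperator.
Variables (F : fieldType) (V : lmodType F) (D : {linear V -> V}).
Implicit Types (p q : {poly F}) (v : V).

Definition polyop p v : V := \sum_(i < size p) p`_i *: iter i D v.

Lemma polyop_widen m p v : (size p <= m)%N -> polyop p v = \sum_(i < m) p`_i *: iter i D v.
Proof.
move=> pm; rewrite /polyop (big_ord_widen m (fun i => p`_i *: iter i D v) pm).
rewrite big_mkcond /=; apply: eq_bigr => i _; case: ltnP => // /(nth_default 0) ->.
by rewrite scale0r.
Qed.

Lemma polyopD p q v : polyop (p + q) v = polyop p v + polyop q v.
Proof.
pose m := maxn (size p) (size q).
rewrite !(@polyop_widen m) ?leq_maxl ?leq_maxr ?size_polyD// -big_split /=.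
by apply: eq_bigr => i _; rewrite coefD scalerDl.
Qed.

Lemma polyop0 v : polyop 0 v = 0.
Proof. by rewrite /polyop size_poly0 big_ord0. Qed.

Lemma polyop_sum I (r : seq I) (P : pred I) (f : I -> {poly F}) v :
  polyop (\sum_(i <- r | P i) f i) v = \sum_(i <- r | P i) polyop (f i) v.
Proof. by elim/big_rec2: _ => [|i w p _ <-]; rewrite ?polyop0 ?polyopD. Qed.

Lemma polyopC c v : polyop c%:P v = c *: v.
Proof. by rewrite (@polyop_widen 1) ?size_polyC_leq1// big_ord1 coefC. Qed.

Lemma polyopZ c p v : polyop (c *: p) v = c *: polyop p v.
Proof.
rewrite (@polyop_widen (size p)) ?size_scale_leq// scaler_sumr.
by apply: eq_bigr => i _; rewrite coefZ scalerA.
Qed.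

Lemma polyopN p v : polyop (- p) v = - polyop p v.
Proof. by rewrite -(scaleN1r p) polyopZ scaleN1r. Qed.

Lemma polyopMX p v : polyop (p * 'X) v = D (polyop p v).
Proof.
rewrite (@polyop_widen (size p).+1) ?(leq_trans (size_polyMleq _ _))// ?size_polyX ?addn2//.
rewrite big_ord_recl coefMX eqxx scale0r add0r linear_sum /=.
by apply: eq_bigr => i _; rewrite coefMX /= linearZ.
Qed.

Lemma polyop_linear p : linear (polyop p).
Proof.
move=> c v w; rewrite scaler_sumr -big_split /=; apply: eq_bigr => i _.
rewrite scalerA mulrC -scalerA -scalerDr; congr (_ *: _).
by elim: (i : nat) => //= j ->; rewrite linearP.
Qed.

HB.instance Definition _ p := GRing.isLinear.Build F V V _ (polyop p) (polyop_linear p).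

Lemma polyopM p q v : polyop (p * q) v = polyop p (polyop q v).
Proof.
elim/poly_ind: p => [|p c IH]; first by rewrite mul0r !polyop0.
by rewrite mulrDl !polyopD mulrAC !polyopMX IH mul_polyC polyopZ polyopC.
Qed.

(* Cramer's rule in the ring of differential operators: with [P = adj (E D - A)]
   one has [(E D - A) P = q(D)] for [q] the determinant of the pencil. *)
Lemma pencil_surjective n (E A : 'M[F]_n) (b : 'I_n -> V) :
  (forall w, exists v, polyop (\det ('X *: map_mx polyC E - map_mx polyC A)) v = w) ->
  exists x : 'I_n -> V, forall i,
    \sum_j E i j *: D (x j) = \sum_j A i j *: x j + b i.
Proof.
set M := _ - _ => surj.
have [z zb] := choice (fun j => surj (b j)).
exists (fun k => \sum_j polyop (\adj M k j) (z j)) => i.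
apply/eqP; rewrite addrC -subr_eq -sumrB; apply/eqP.
transitivity (\sum_j \sum_k polyop (M i k * \adj M k j) (z j)).
  rewrite exchange_big; apply: eq_bigr => k _ /=.
  under [RHS]eq_bigr => j _ do rewrite polyopM.
  rewrite -linear_sum /= !mxE polyopD polyopN polyopC.
  by rewrite (mulrC (polyX F)) polyopMX polyopC [in RHS]linearZ.
transitivity (\sum_j polyop ((M *m \adj M) i j) (z j)).
  by apply: eq_bigr => j _; rewrite mxE polyop_sum.
rewrite mul_mx_adj (bigD1 i) //= big1 ?addr0 => [|j ji].
  by rewrite mxE eqxx mulr1n.
by rewrite mxE eq_sym (negPf ji) mulr0n polyop0.
Qed.

End PolyOperator.

(** Induction on the size. A nonconstant [q] has a complex root [a + i b]; a real root splits off
    [X - a], a nonreal one the quadratic [(X - a)^2 + b^2]. *)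
Lemma real_poly_factor_ind (R : rcfType) (P : {poly R} -> Prop) :
  (forall c, c != 0 -> P c%:P) ->
  (forall a p, P p -> P (p * ('X - a%:P))) ->
  (forall a b p, b != 0 -> P p -> P (p * (('X - a%:P) ^+ 2 + (b ^+ 2)%:P))) ->
  forall q, q != 0 -> P q.
Proof.
move=> PC Plin Pquad q; move: {2}(size q) (leqnn (size q)) => m.
elim: m q => [|m IH] q; first by rewrite leqn0 size_poly_eq0 => ->.
move=> qm q0.
have [/size1_polyC qC|q1] := leqP (size q) 1.
  by rewrite qC; apply: PC; rewrite -polyC_eq0 -qC.
have : size (map_poly (real_complex R) q) != 1 by rewrite size_map_poly; case: (size q) q1 => [|[]].
move=> /closed_rootP[[a b] rz].
have [b0|b0] := eqVneq b 0.
  move: rz; rewrite b0 -/(real_complex R a) fmorph_root => /factor_theorem[p qE].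
  rewrite qE; apply: Plin.
  have p0 : p != 0 by apply: contraNneq q0 => p0; rewrite qE p0 mul0r.
  by apply: IH => //; move: qm; rewrite qE size_Mmonic ?monicXsubC// size_XsubC addn2.
pose d := ('X - a%:P) ^+ 2 + (b ^+ 2)%:P : {poly R}.
have sd : size d = 3%N.
  rewrite /d size_polyDl size_exp_XsubC//.
  by rewrite (leq_ltn_trans (size_polyC_leq1 _)).
have d0 : d != 0 by rewrite -size_poly_eq0 sd.
have dz : (map_poly (real_complex R) d).[(a +i* b)%C] = 0.
  rewrite /d rmorphD rmorphXn rmorphB /= map_polyX !map_polyC /= !hornerE /=.
  by apply/eqP; rewrite eq_complex /= !expr2 /=; apply/andP; split; apply/eqP; ring.
have qE := divp_eq q d.
have sr : (size (q %% d)%R <= 2)%N by rewrite -ltnS -sd ltn_modp.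
(* The remainder has degree at most 1 and real coefficients, and vanishes at the nonreal point
   [a + i b]: the imaginary part kills its slope, then the real part its constant term. *)
have r0 : (q %% d)%R = 0.
  have : (map_poly (real_complex R) (q %% d)).[(a +i* b)%C] = 0.
    move: rz; rewrite /root {1}qE rmorphD rmorphM /= hornerD hornerM dz mulr0 add0r.
    by move/eqP.
  rewrite (horner_coef_wide _ (n := 2)) ?size_map_poly// !big_ord_recr big_ord0 /=.
  rewrite !coef_map /= add0r expr0 expr1 mulr1 => /eqP.
  rewrite eq_complex /= !mul0r !add0r subr0 addr0 mulf_eq0 (negPf b0) orbF.
  move=> /andP[re /eqP im]; move: re; rewrite im mul0r addr0 => /eqP re.
  apply/polyP => i; rewrite coef0.
  by case: i => [|[|i]]//; rewrite nth_default// (leq_trans sr).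
rewrite qE r0 addr0; apply: Pquad => //.
have p0 : (q %/ d)%R != 0 by apply: contraNneq q0 => p0; rewrite qE p0 mul0r r0 addr0.
apply: IH => //; move: qm; rewrite {1}qE r0 addr0 size_mul// sd addn3 /=.
by move/ltnW.
Qed.

(** * Solvability of regular pencils *)

Definition smooth_pred (R : realType) : {pred (R -> R)} := fun f => `[< smooth f >].

Lemma smooth_predP (R : realType) (f : R -> R) : reflect (smooth f) (f \in @smooth_pred R).
Proof. exact: asboolP. Qed.

Lemma smooth_submod_closed (R : realType) : submod_closed (@smooth_pred R).
Proof.
split; first by apply/smooth_predP; exact: smooth0.
by move=> c f g /smooth_predP sf /smooth_predP sg; apply/smooth_predP; exact: smooth_lin.
Qed.

HB.instance Definition _ (R : realType) :=
  GRing.isSubmodClosed.Build R (R -> R) (@smooth_pred R) (@smooth_submod_closed R).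

(** Smooth functions are packed into a module because [polyop] needs differentiation as a linear
    endomorphism; on all functions [derive1] is not linear. *)
Record smooth_fun (R : realType) :=
  SmoothFun { smooth_val : R -> R; smooth_valP : smooth_val \in @smooth_pred R }.

HB.instance Definition _ (R : realType) := [isSub for @smooth_val R].
HB.instance Definition _ (R : realType) := [Choice of smooth_fun R by <:].
HB.instance Definition _ (R : realType) := [SubChoice_isSubLmodule of smooth_fun R by <:].

Section SmoothFun.
Variable R : realType.
Implicit Types f g : smooth_fun R.

Lemma smooth_funP f : smooth (val f).
Proof. by apply/smooth_predP; exact: valP. Qed.

Lemma smooth_fun_derive1_subproof f : derive1 (val f) \in @smooth_pred R.
Proof. by apply/smooth_predP/smooth_derive1/smooth_funP. Qed.

Definition smooth_derive f : smooth_fun R := SmoothFun (smooth_fun_derive1_subproof f).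

Lemma smooth_derive_linear : linear smooth_derive.
Proof.
move=> c f g; apply: val_inj; rewrite linearP /=.
rewrite derive1_lin // => t; exact/smooth_derivable/smooth_funP.
Qed.

HB.instance Definition _ :=
  GRing.isLinear.Build R (smooth_fun R) (smooth_fun R) _ smooth_derive smooth_derive_linear.

Lemma smooth_valD f g t : val (f + g) t = val f t + val g t.
Proof. by []. Qed.

Lemma smooth_valN f t : val (- f) t = - val f t.
Proof. by []. Qed.

Lemma smooth_valZ c f t : val (c *: f) t = c * val f t.
Proof. by []. Qed.

Lemma smooth_val_sum m (F : 'I_m -> smooth_fun R) t :
  val (\sum_i F i) t = \sum_i val (F i) t.
Proof. exact: (big_morph (fun f => val f t) (fun f g => smooth_valD f g t)). Qed.

Lemma smooth_spiral a b f : exists z w : smooth_fun R,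
  smooth_derive z = a *: z + b *: w /\ smooth_derive w = a *: w - b *: z + f.
Proof.
have [z [w [sz sw dz dw]]] := exists_smooth_spiral a b (@smooth_funP f).
exists (SmoothFun (introT (smooth_predP _) sz)), (SmoothFun (introT (smooth_predP _) sw)).
split; apply: val_inj; apply/funext => t.
  by rewrite smooth_valD !smooth_valZ; exact: dz.
by rewrite !smooth_valD smooth_valN !smooth_valZ; exact: dw.
Qed.

(** One factor of [q] is inverted at a time. For a linear factor the spiral with [b = 0] decouples,
    and its second component solves [z' = a z + v]. *)
Lemma polyop_smooth_surjective q (w : smooth_fun R) :
  q != 0 -> exists v, polyop (@smooth_derive) q v = w.
Proof.
move=> q0; move: w.
apply: (real_poly_factor_ind (P := fun q => forall w, exists v, polyop (@smooth_derive) q v = w))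
  q q0 => [c c0|a p IH|a b p b0 IH] w.
- by exists (c^-1 *: w); rewrite polyopC scalerA divff ?scale1r.
- have [v vw] := IH w; have [y [z [_ dz]]] := smooth_spiral a 0 v.
  exists z; rewrite polyopM polyopD polyopN polyopC -(mul1r 'X) polyopMX polyopC scale1r /=.
  by rewrite dz scale0r subr0 addrAC subrr add0r.
- have [v vw] := IH w; have [z [u [dz du]]] := smooth_spiral a b v.
  have linop y : polyop (@smooth_derive) ('X - a%:P) y = smooth_derive y - a *: y.
    by rewrite polyopD polyopN polyopC -(mul1r 'X) polyopMX polyopC scale1r.
  (* With [y = z / b], one has [(D - a) y = u] and [(D - a) u = v - b z]; the term [b^2 y = b z] of
     the quadratic factor then leaves exactly [v]. *)
  have e : polyop (@smooth_derive) ('X - a%:P) (b^-1 *: z) = u.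
    by rewrite linop linearZ /= dz scalerDr !scalerA mulVf// scale1r mulrC addrAC subrr add0r.
  exists (b^-1 *: z); rewrite polyopM -vw polyopD expr2 polyopM polyopC e linop du.
  congr (polyop _ p _); rewrite scalerA expr2 mulfK//.
  by rewrite addrAC [X in X - _]addrAC addrNK addrAC subrr add0r.
Qed.

End SmoothFun.

Lemma regular_pencil_solvable (R : realType) n (E A : 'M[R]_n) (b : R -> 'cV[R]_n) :
  regular_pencil E A -> smooth_signal b ->
  exists x : R -> 'cV[R]_n, smooth_signal x /\
    forall t, E *m time_derivative x t = A *m x t + b t.
Proof.
move=> [s regs] sb.
pose M := 'X *: map_mx polyC E - map_mx polyC A.
(* Evaluation at [s] is a ring morphism, so it sends the determinant of [M] to that of the complex
   pencil, nonzero by regularity. *)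
have M0 : \det M != 0.
  apply: contraNneq regs => M0.
  have := congr1 (fun p => (map_poly (real_complex R) p).[s]) M0.
  rewrite /= rmorph0 horner0 -[LHS](det_map_mx (horner_eval s \o map_poly (real_complex R))).
  move=> <-; apply/eqP; congr (\det _); apply/matrixP => i j.
  rewrite !mxE /= /horner_eval rmorphB rmorphM /= map_polyX !map_polyC /=.
  by rewrite !hornerE.
pose B i : smooth_fun R := SmoothFun (introT (smooth_predP _) (fun k t => sb i k t)).
have [x xE] := pencil_surjective B (fun w => polyop_smooth_surjective w M0).
exists (fun t => \col_i (val (x i) t)); split.
  move=> i k t; rewrite (_ : (fun _ => _) = val (x i)); first exact: smooth_funP.
  by apply/funext => u; rewrite mxE.
move=> t; apply/colP => i; rewrite !mxE.
have := congr1 (fun f => val f t) (xE i).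
rewrite smooth_valD !smooth_val_sum => xi.
transitivity (\sum_j val (E i j *: smooth_derive (x j)) t).
  apply: eq_bigr => j _; rewrite mxE.
  rewrite (_ : (fun u : R => (\col_k val (x k) u) j 0) = val (x j))//.
  by apply/funext => u; rewrite mxE.
by rewrite xi; congr (_ + _); apply: eq_bigr => j _; rewrite mxE.
Qed.

(** * Eigenmodes of trajectories *)

Section Modes.
Variable R : realType.

(** The derivative is computed as a limit from the right, since at [t = 0] nothing is known about
    [f] on the left. *)
Lemma derive1_eq0_halfline (f : R -> R) (t : R) : 0 <= t -> derivable f t (1 : R) ->
  (forall s, 0 <= s -> f s = 0) -> derive1 f t = 0.
Proof.
move=> t0 df f0; rewrite derive1E.
have cf : h^-1 *: (f (h *: 1 + t) - f t) @[h --> 0^'+] --> 'D_1 f t.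
  exact: cvg_dnbhs_at_right df.
rewrite -(cvg_lim _ cf)//; apply: cvg_lim => //; apply: cvg_near_cst.
near=> h.
rewrite !f0 ?subrr ?scaler0//.
rewrite addr_ge0// /GRing.scale /= mulr1.
by near: h; exact: nbhs_right_ge.
Unshelve. all: by end_near. Qed.

Lemma mulmx_time_derivative n q (F : 'M[R]_(q, n)) (x : R -> 'cV[R]_n) (t : R) :
  (forall i, derivable (fun s => x s i 0) t (1 : R)) ->
  (forall j, derivable (fun s => (F *m x s) j 0) t (1 : R)) /\
  time_derivative (fun s => F *m x s) t = F *m time_derivative x t.
Proof.
move=> dx.
have D j : is_derive t (1 : R) (fun s => (F *m x s) j 0) ((F *m time_derivative x t) j 0).
  have -> : (fun s => (F *m x s) j 0) = \sum_i (F j i *: (fun s => x s i 0)).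
    by apply/funext => s; rewrite mxE fct_sumE; apply: eq_bigr.
  rewrite mxE; apply: is_derive_sum => i; rewrite mxE derive1E.
  by apply: is_deriveZ; apply: derivableP.
split=> [j|]; first by have [] := D j.
by apply/colP => j; rewrite mxE; apply: is_derive1E.
Qed.

Lemma closed_eigenvector (F : closedFieldType) r (T : 'M[F]_r) : (0 < r)%N ->
  exists s (c : 'rV[F]_r), c != 0 /\ c *m T = s *: c.
Proof.
move=> r0; have : size (char_poly T) != 1 by rewrite size_char_poly eqSS -lt0n.
move=> /closed_rootP[s]; rewrite -eigenvalue_root_char => /eigenvalueP[c cT c0].
by exists s, c.
Qed.

(* The span of the positions is finite-dimensional and stable under
   differentiation, so differentiation acts on it by a matrix, and [z] is an
   eigenvector of that matrix. *)
Lemma trajectory_mode n (x : R -> 'cV[R]_n) (t0 : R) :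
  (forall t, 0 <= t -> forall i, derivable (fun s => x s i 0) t (1 : R)) ->
  0 <= t0 -> x t0 != 0 ->
  exists (s : R[i]) (z : 'cV[R[i]]_n), z != 0 /\
    forall q (F G : 'M[R]_(q, n)),
      (forall t, 0 <= t -> F *m time_derivative x t = G *m x t) ->
      s *: (cmx F *m z) = cmx G *m z.
Proof.
move=> dx t00 xt0.
pose samples m (ts : 'I_m -> R) := \matrix_(j < m) (x (ts j))^T.
(* The ranks of finite samples of positions are at most [n]. A sample [Y] of maximal rank is taken;
   its row space is the span of all positions. *)
pose P r := `[< exists m (ts : 'I_m -> R), (forall j, 0 <= ts j) /\ \rank (samples m ts) = r >].
have exP : exists r, P r.
  by exists (\rank (samples 0 (fun=> 0))); apply/asboolP; exists 0, (fun=> 0).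
have leP r : P r -> (r <= n)%N by move=> /asboolP[m [ts [_ <-]]]; exact: rank_leq_col.
case: (ex_maxnP exP leP) => r /asboolP[m [ts [ts0 rkY]]] maxr.
set Y := samples m ts in rkY.
have xY t : 0 <= t -> ((x t)^T <= Y)%MS.
  move=> tge0.
  (* Adding the time [t] to the sample cannot raise the maximal rank, so [x t] already lies in the
     row space of [Y]. *)
  pose ts' (j : 'I_(1 + m)) := if fintype.split j is inr k then ts k else t.
  have sE : samples (1 + m)%N ts' = col_mx (x t)^T Y.
    apply/row_matrixP => j; rewrite rowK /ts'.
    rewrite -(fintype.splitK j); case: (fintype.split j) => k;
      rewrite unsplitK /= ?rowKu ?rowKd ?rowK//.
    by rewrite [k]ord1 row_id.
  have rk : (\rank (col_mx (x t)^T Y) <= r)%N.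
    rewrite -sE; apply: maxr; apply/asboolP; exists (1 + m)%N, ts'; split=> // j.
    by rewrite /ts'; case: fintype.split.
  have sub : (Y <= col_mx (x t)^T Y)%MS by rewrite -addsmxE addsmxSr.
  have := mxrank_leqif_sup sub; rewrite rkY => -[rk' /esym].
  rewrite eqn_leq rk' rk => col_sub.
  by apply: submx_trans col_sub; rewrite -addsmxE addsmxSl.
(* The cokernel of [Y] annihilates all positions on the half-line, hence also their derivatives. *)
have dxY t : 0 <= t -> ((time_derivative x t)^T <= Y)%MS.
  move=> tge0; rewrite submxE -[cokermx Y]trmxK -trmx_mul.
  have [dQ <-] := mulmx_time_derivative (cokermx Y)^T (dx t tge0).
  rewrite -trmx0; apply/eqP; congr (_^T); apply/colP => j; rewrite !mxE.
  apply: derive1_eq0_halfline => // s s0.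
  rewrite -[x s]trmxK -trmx_mul; have := xY s s0; rewrite submxE => /eqP ->.
  by rewrite !mxE.
pose Y' := \matrix_(j < m) (time_derivative x (ts j))^T.
have Y'Y : (Y' <= Y)%MS by apply/row_subP => j; rewrite rowK dxY.
pose Z := row_base Y.
have /submxP[N ZE] : (Z <= Y)%MS by rewrite eq_row_base.
(* [T] is the matrix of differentiation on the basis [Z = N *m Y]. Positions are stored as rows, so
   a left eigenvector [c] is taken and [z] is the transpose of [c *m Z]. *)
have /submxP[T TE] : (N *m Y' <= Z)%MS.
  by rewrite eq_row_base (submx_trans _ Y'Y)// submxMl.
have r0 : (0 < \rank Y)%N.
  rewrite lt0n mxrank_eq0; apply: contra xt0 => /eqP Y0.
  by have /submxP[d] := xY t0 t00; rewrite Y0 mulmx0 => e; rewrite -[x t0]trmxK e trmx0.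
have [s [c [c0 cT]]] := closed_eigenvector (cmx T) r0.
exists s, (c *m cmx Z)^T; split.
  apply: contra c0 => /eqP e; apply/eqP.
  apply: (row_free_inj (A := cmx Z)); first by rewrite row_free_map row_base_free.
  by rewrite mul0mx -[LHS]trmxK e trmx0.
move=> q F G FG.
(* The relation holds at the sample times, thus for the combinations of samples given by [N];
   multiplying by [c] then replaces [T] by [s]. *)
have YF : Y' *m F^T = Y *m G^T.
  apply/row_matrixP => j; rewrite !row_mul !rowK -!trmx_mul FG//.
have ZF : cmx (N *m Y') *m (cmx F)^T = cmx Z *m (cmx G)^T.
  by rewrite /cmx !map_trmx -!map_mxM ZE -!mulmxA YF.
apply: trmx_inj; rewrite linearZ /= !trmx_mul !trmxK.
rewrite -!mulmxA -ZF TE [cmx (T *m Z)]map_mxM !mulmxA [map_mx _ T]/(cmx T) cT.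
by rewrite !scalemxAl.
Qed.

End Modes.

(** * Inputs supported on an index set *)

Section Spread.
Variables (F : pzRingType) (m : nat).
Implicit Types (K S : {set 'I_m}) (u : 'cV[F]_m).

(** Extension by zero, which brings attacks on different sets into one space. Being a matrix
    product, it inherits linearity and smoothness from [mulmx]. *)
Definition spread K (v : 'cV[F]_#|K|) : 'cV[F]_m := colset 1%:M K *m v.
Definition entries_on K u : 'cV[F]_#|K| := \col_j u (enum_val j) 0.

Lemma colsetE r (M : 'M[F]_(r, m)) K : colset M K = M *m colset 1%:M K.
Proof. by rewrite /colset mulmx_colsub mulmx1. Qed.

Lemma spreadE K (v : 'cV[F]_#|K|) i : spread v i 0 = \sum_(j | enum_val j == i) v j 0.
Proof.
rewrite mxE [RHS]big_mkcond; apply: eq_bigr => j _.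
by rewrite !mxE eq_sym; case: eqP; rewrite ?mul1r ?mul0r.
Qed.

Lemma spread_enum_val K (v : 'cV[F]_#|K|) j : spread v (enum_val j) 0 = v j 0.
Proof.
rewrite spreadE (eq_bigl (pred1 j)) ?big_pred1_eq// => k.
by rewrite (inj_eq enum_val_inj).
Qed.

Lemma spread_notin K (v : 'cV[F]_#|K|) i : i \notin K -> spread v i 0 = 0.
Proof.
by move=> iK; rewrite spreadE big1// => j /eqP ji; move: iK; rewrite -ji enum_valP.
Qed.

Lemma spread_in K (v : 'cV[F]_#|K|) i (iK : i \in K) :
  spread v i 0 = v (enum_rank_in iK i) 0.
Proof. by rewrite -[in LHS](enum_rankK_in iK iK) spread_enum_val. Qed.

Lemma spread_entries_on K u : (forall i, i \notin K -> u i 0 = 0) ->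
  spread (entries_on K u) = u.
Proof.
move=> uK; apply/colP => i; have [iK|iK] := boolP (i \in K).
  by rewrite spread_in mxE enum_rankK_in.
by rewrite spread_notin// uK.
Qed.

Lemma spread0 K : spread (0 : 'cV[F]_#|K|) = 0.
Proof. exact: mulmx0. Qed.

Lemma spreadN K (v : 'cV[F]_#|K|) : spread (- v) = - spread v.
Proof. exact: mulmxN. Qed.

(** Entries on the overlap are all given to [K]; [S] receives only those outside [K]. *)
Lemma spread_setU K S u : (forall i, i \notin K :|: S -> u i 0 = 0) ->
  exists (v : 'cV[F]_#|K|) (w : 'cV[F]_#|S|), u = spread v + spread w.
Proof.
move=> uKS; pose w : 'cV[F]_m := \col_i (if i \in K then 0 else u i 0).
exists (entries_on K (u - w)), (entries_on S w).
rewrite !spread_entries_on ?subrK// => i iK; rewrite !mxE.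
  by case: ifP => // iK'; apply: uKS; rewrite inE iK' (negPf iK).
by rewrite (negPf iK) subrr.
Qed.

End Spread.

(** * Attack matrices as the upper and lower parts of a spread input *)

Section Inputs.
Variables (R : realType) (n p : nat).
Implicit Types (K : {set 'I_(n + p)}).

Lemma row_mx1_0_mul (F : pzRingType) (u : 'cV[F]_(n + p)) : row_mx 1%:M 0 *m u = usubmx u.
Proof. by rewrite -[u in LHS]vsubmxK mul_row_col mul1mx mul0mx addr0. Qed.

Lemma row_mx0_1_mul (F : pzRingType) (u : 'cV[F]_(n + p)) : row_mx 0 1%:M *m u = dsubmx u.
Proof. by rewrite -[u in LHS]vsubmxK mul_row_col mul1mx mul0mx add0r. Qed.

Lemma BK_mul K v : BK R K *m v = usubmx (spread v).
Proof. by rewrite /BK colsetE -mulmxA row_mx1_0_mul. Qed.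

Lemma DK_mul K v : DK R K *m v = dsubmx (spread v).
Proof. by rewrite /DK colsetE -mulmxA row_mx0_1_mul. Qed.

Lemma cmx_colset r m (M : 'M[R]_(r, m)) (K : {set 'I_m}) : cmx (colset M K) = colset (cmx M) K.
Proof. by apply/matrixP => i j; rewrite !mxE. Qed.

Lemma cmx_BK_mul K v : cmx (BK R K) *m v = usubmx (spread v).
Proof.
rewrite cmx_colset colsetE -mulmxA -row_mx1_0_mul /spread; congr (_ *m _).
by rewrite /cmx map_row_mx map_mx1 map_mx0.
Qed.

Lemma cmx_DK_mul K v : cmx (DK R K) *m v = dsubmx (spread v).
Proof.
rewrite cmx_colset colsetE -mulmxA -row_mx0_1_mul /spread; congr (_ *m _).
by rewrite /cmx map_row_mx map_mx1 map_mx0.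
Qed.

End Inputs.

(** * Derivatives and smoothness of vector signals *)

Section Signals.
Variable R : realType.

Lemma time_derivativeD m (x y : R -> 'cV[R]_m) t :
  (forall i, derivable (fun s => x s i 0) t (1 : R)) ->
  (forall i, derivable (fun s => y s i 0) t (1 : R)) ->
  (forall i, derivable (fun s => (x s + y s) i 0) t (1 : R)) /\
  time_derivative (fun s => x s + y s) t = time_derivative x t + time_derivative y t.
Proof.
move=> dx dy.
have D i : is_derive t (1 : R) (fun s => (x s + y s) i 0)
   (time_derivative x t i 0 + time_derivative y t i 0).
  rewrite (_ : (fun s => (x s + y s) i 0) = (fun s => x s i 0) + (fun s => y s i 0)).
    by rewrite !mxE !derive1E; apply: is_deriveD; apply: derivableP.
  by apply/funext => s; rewrite mxE.
split=> [i|]; first by have [] := D i.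
by apply/colP => i; rewrite !mxE; have := is_derive1E (D i); rewrite !mxE.
Qed.

Lemma time_derivativeN m (x : R -> 'cV[R]_m) t :
  (forall i, derivable (fun s => x s i 0) t (1 : R)) ->
  (forall i, derivable (fun s => (- x s) i 0) t (1 : R)) /\
  time_derivative (fun s => - x s) t = - time_derivative x t.
Proof.
move=> dx; have := mulmx_time_derivative (- 1%:M) dx.
rewrite mulNmx mul1mx (_ : (fun s => - 1%:M *m x s) = (fun s => - x s)).
  move=> [d e]; split=> [i|]; last exact: e.
  rewrite (_ : (fun s => (- x s) i 0) = (fun s => (- 1%:M *m x s) i 0)).
    exact: d i.
  by apply/funext => s; rewrite mulNmx mul1mx.
by apply/funext => s; rewrite mulNmx mul1mx.
Qed.

Lemma smooth_signalN m (u : R -> 'cV[R]_m) : smooth_signal u -> smooth_signal (fun t => - u t).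
Proof.
move=> su i; rewrite (_ : (fun s => (- u s) i 0) = (-1) *: (fun s => u s i 0) + 0).
  exact: smooth_lin (su i) (@smooth0 R).
by apply/funext => s; rewrite addr0 mxE; exact: (esym (mulN1r _)).
Qed.

Lemma smooth_signalD m (u v : R -> 'cV[R]_m) :
  smooth_signal u -> smooth_signal v -> smooth_signal (fun t => u t + v t).
Proof.
move=> su sv i.
rewrite (_ : (fun s => (u s + v s) i 0) =
    1 *: (fun s => u s i 0) + (fun s => v s i 0)).
  exact: smooth_lin (su i) (sv i).
by apply/funext => s; rewrite scale1r mxE.
Qed.

Lemma smooth_cst (c : R) : smooth (fun=> c).
Proof.
move=> [|k] t; first exact: derivable_cst.
rewrite derive1Sn (_ : derive1 (fun=> c) = 0); first exact: smooth0.
by apply: derive1_fun => u; exact: is_derive_cst.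
Qed.

Lemma smooth_signal_mulmx m q (M : 'M[R]_(q, m)) (u : R -> 'cV[R]_m) :
  smooth_signal u -> smooth_signal (fun t => M *m u t).
Proof.
move=> su i; rewrite (_ : (fun s => (M *m u s) i 0) = \sum_j (M i j *: (fun s => u s j 0) + 0)).
  elim/big_rec: _ => [|j f _ sf]; first exact: smooth0.
  rewrite -[X in X + _]scale1r; apply: smooth_lin sf.
  exact: smooth_lin (su j) (@smooth0 R).
by apply/funext => s; rewrite mxE fct_sumE; apply: eq_bigr => j _; rewrite addr0.
Qed.

Lemma smooth_signal_derivable m (u : R -> 'cV[R]_m) t i :
  smooth_signal u -> derivable (fun s => u s i 0) t (1 : R).
Proof. by move=> su; exact: (su i 0). Qed.

End Signals.

(** * Zero-output trajectories *)

Section Flow.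
Variables (R : realType) (n p : nat) (E A : 'M[R]_n) (C : 'M[R]_(p, n)).
Implicit Types (K S : {set 'I_(n + p)}) (u : R -> 'cV[R]_(n + p)) (x : R -> 'cV[R]_n).

Definition zero_flow u x : Prop :=
  [/\ forall t, 0 <= t -> forall i, derivable (fun s => x s i 0) t (1 : R),
      forall t, 0 <= t -> E *m time_derivative x t = A *m x t + usubmx (u t)
    & forall t, 0 <= t -> 0 = C *m x t + dsubmx (u t)].

(** At time 0 the vector [A x + b] equals [E x'], which is orthogonal to every [v] with [E^T v = 0];
    this gives consistency of the initial state. *)
Lemma state_trajectoryP (b : R -> 'cV[R]_n) (x0 : 'cV[R]_n) x :
  state_trajectory E A b x0 x <->
  [/\ x 0 = x0, forall t, 0 <= t -> forall i, derivable (fun s => x s i 0) t (1 : R)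
    & forall t, 0 <= t -> E *m time_derivative x t = A *m x t + b t].
Proof.
split=> [[_ x00 dx eqx]|[x00 dx eqx]]; first by split.
split=> // v Ev; rewrite -x00 -eqx// mulmxA -[v^T *m E]trmxK trmx_mul trmxK Ev.
by rewrite trmx0 mul0mx.
Qed.

Lemma zeroing_trajectoryP K S (uK : R -> 'cV[R]_#|K|) (uS : R -> 'cV[R]_#|S|)
    (x0 : 'cV[R]_n) x :
  zeroing_trajectory E A C uK uS x0 x <->
  x 0 = x0 /\ zero_flow (fun t => spread (uK t) + spread (uS t)) x.
Proof.
split=> [[/state_trajectoryP[x00 dx eqx] eqy]|[x00 [dx eqx eqy]]].
  split=> //; split=> // t t0.
    by rewrite eqx// !BK_mul linearD.
  by rewrite {1}(eqy t t0) !DK_mul linearD addrA.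
split; first (apply/state_trajectoryP; split=> // t t0).
  by rewrite eqx// !BK_mul linearD.
by move=> t t0; rewrite {1}(eqy t t0) !DK_mul linearD addrA.
Qed.

Lemma same_output_flow K S (uK : R -> 'cV[R]_#|K|) (uS : R -> 'cV[R]_#|S|)
    (x1 x2 : 'cV[R]_n) :
  same_output E A C uK uS x1 x2 ->
  exists x, x 0 = x1 - x2 /\ zero_flow (fun t => spread (uK t) - spread (uS t)) x.
Proof.
move=> [y1 [y2 [[xa [/state_trajectoryP[xa0 dxa eqa] ya]]
  [xb [/state_trajectoryP[xb0 dxb eqb] yb]] yy]]].
have D t (t0 : 0 <= t) := time_derivativeD (dxa t t0) (time_derivativeN (dxb t t0)).1.
exists (fun t => xa t - xb t); split; first by rewrite xa0 xb0.
split=> [t t0|t t0|t t0]; first exact: (D t t0).1.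
  rewrite (D t t0).2 (time_derivativeN (dxb t t0)).2 mulmxDr mulmxN eqa// eqb//.
  by rewrite !BK_mul mulmxBr linearB opprD addrACA.
have := yy t t0; rewrite ya// yb// !DK_mul => /eqP; rewrite -subr_eq0 => /eqP {1}<-.
by rewrite mulmxBr linearB opprD addrACA.
Qed.

(** Regularity provides a trajectory [xb] driven by [uS] alone; then [x + xb] is driven by [uK], and
    the two outputs differ by the zero output of [x]. *)
Lemma flow_same_output K S (uK : R -> 'cV[R]_#|K|) (uS : R -> 'cV[R]_#|S|) x :
  regular_pencil E A -> smooth_signal uS ->
  zero_flow (fun t => spread (uK t) - spread (uS t)) x ->
  exists x1 x2 : 'cV[R]_n, same_output E A C uK uS x1 x2 /\ x1 - x2 = x 0.
Proof.
move=> regEA suS [dx eqx eqy].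
have [xb [sxb eqb]] := regular_pencil_solvable regEA (@smooth_signal_mulmx _ _ _ (BK R S) _ suS).
have dxb t i : derivable (fun s => xb s i 0) t (1 : R) by exact: smooth_signal_derivable.
have D t (t0 : 0 <= t) := time_derivativeD (dx t t0) (dxb t).
exists (x 0 + xb 0), (xb 0); split; last by rewrite addrK.
exists (fun t => C *m (x t + xb t) + DK R K *m uK t), (fun t => C *m xb t + DK R S *m uS t).
split.
- exists (fun t => x t + xb t); split; last by [].
  apply/state_trajectoryP; split=> [|t t0|t t0]; [by []|exact: (D t t0).1|].
  rewrite (D t t0).2 !mulmxDr eqx// eqb !BK_mul linearB.
  by rewrite addrACA subrK.
- exists xb; split; last by [].
  by apply/state_trajectoryP; split=> [|t t0|t t0]; [|exact: dxb|exact: eqb].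
- move=> t t0; apply/eqP; rewrite -subr_eq0 !DK_mul mulmxDr opprD addrACA addrK.
  by rewrite -linearB -eqy.
Qed.

Lemma zero_flow_eq u v x : (forall t, 0 <= t -> u t = v t) -> zero_flow u x -> zero_flow v x.
Proof. by move=> uv [dx eqx eqy]; split=> // t t0; rewrite -uv//; [exact: eqx|exact: eqy]. Qed.

(** The trajectory determines the input: the state equation gives its upper part and the output
    equation its lower part. *)
Lemma zero_flow_input_eq0 u x : zero_flow u x -> (forall t, 0 <= t -> x t = 0) ->
  forall t, 0 <= t -> u t = 0.
Proof.
move=> [dx eqx eqy] x0 t t0; rewrite -[u t]vsubmxK.
have : time_derivative x t = 0.
  apply/colP => i; rewrite !mxE; apply: derive1_eq0_halfline => //; first exact: dx.
  by move=> s s0; rewrite x0// mxE.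
move=> dx0; have := eqx t t0; rewrite dx0 x0// !mulmx0 add0r => <-.
by have := eqy t t0; rewrite x0// mulmx0 add0r => <-; rewrite col_mx0.
Qed.

(** The frequency-domain counterpart of [zero_flow], with the input direction [g] in full length. *)
Definition zero_mode (s : R[i]) (z : 'cV[R[i]]_n) (g : 'cV[R[i]]_(n + p)) : Prop :=
  (s *: cmx E - cmx A) *m z = usubmx g /\ cmx C *m z + dsubmx g = 0.

Lemma invariant_zeroP K S s (gK : 'cV[R[i]]_#|K|) (gS : 'cV[R[i]]_#|S|) z :
  invariant_zero E A C s gK gS z <-> z != 0 /\ zero_mode s z (spread gK + spread gS).
Proof.
rewrite /invariant_zero /zero_mode !cmx_BK_mul !cmx_DK_mul !linearD /= addrA.
by split=> [[z0 e1 e2]|[z0 [e1 e2]]]; split=> //;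
  [split=> //; apply/eqP; rewrite -subr_eq0 opprD addrA e1|rewrite e1 -addrA -opprD subrr].
Qed.

Lemma flow_mode (L : {set 'I_(n + p)}) u x t0 :
  zero_flow u x -> (forall t, 0 <= t -> forall i, i \notin L -> u t i 0 = 0) ->
  0 <= t0 -> x t0 != 0 ->
  exists s z g, [/\ z != 0, zero_mode s z g & forall i, i \notin L -> g i 0 = 0].
Proof.
move=> [dx eqx eqy] uL t00 xt0.
have [s [z [z0 mode]]] := trajectory_mode dx t00 xt0.
(* The equations force this [g]. It remains to see that it vanishes outside [L], where each equation
   is free of input and so passes from [x] to [z]. *)
exists s, z, (col_mx ((s *: cmx E - cmx A) *m z) (- (cmx C *m z))).
split=> [//||i]; first by split; rewrite ?col_mxKu// col_mxKd subrr.
rewrite -(fintype.splitK i); case: (fintype.split i) => j /= jL.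
  rewrite col_mxEu mulmxBl -scalemxAl.
  transitivity ((s *: (cmx (row j E) *m z) - cmx (row j A) *m z) 0 0).
    by rewrite /cmx !map_row -!row_mul !mxE.
  rewrite (mode _ _ (row j A)) ?subrr ?mxE// => t tge0.
  rewrite -!row_mul eqx//; apply/rowP => k; rewrite !mxE [k]ord1.
  by rewrite uL ?addr0.
transitivity (- (cmx (row j C) *m z) 0 0); first by rewrite col_mxEd /cmx map_row -row_mul !mxE.
(* A sensor equation is algebraic, that is, a relation with [F = 0]. *)
rewrite -(mode _ 0 (row j C)); last first.
  move=> t tge0; rewrite mul0mx -row_mul; apply/rowP => k; rewrite [k]ord1.
  by have /colP/(_ j) := eqy t tge0; rewrite !mxE uL// addr0.
by rewrite /cmx map_mx0 mul0mx scaler0 mxE oppr0.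
Qed.

Lemma flow_pencil_condition K S u x t0 : (#|S| <= #|K|)%N -> S != K ->
  zero_flow u x -> (forall t, 0 <= t -> forall i, i \notin K :|: S -> u t i 0 = 0) ->
  0 <= t0 -> x t0 != 0 -> pencil_condition E A C K.
Proof.
move=> SK nSK fl uKS t00 xt0.
have [s [z [g [z0 mode gKS]]]] := flow_mode fl uKS t00 xt0.
have [gK [gS gE]] := spread_setU gKS.
by exists S, s, gK, gS, z; split=> //; apply/invariant_zeroP; split=> //; rewrite -gE.
Qed.

End Flow.

(** * Real parts of complex modes *)

Section RealModes.
Variable R : realType.

(** The complex exponential [exp(s t)], given by its real and imaginary parts. *)
Definition cexp (s : R[i]) (t : R) : R[i] :=
  Complex (expR (complex.Re s * t) * cos (complex.Im s * t))
          (expR (complex.Re s * t) * sin (complex.Im s * t)).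

Definition real_mode m (s : R[i]) (v : 'cV[R[i]]_m) (t : R) : 'cV[R]_m :=
  \col_i complex.Re (cexp s t * v i 0).

Lemma real_mode0 m s (v : 'cV[R[i]]_m) i : real_mode s v 0 i 0 = complex.Re (v i 0).
Proof.
rewrite mxE /cexp !mulr0 expR0 cos0 sin0 mulr0 mulr1.
by case: (v i 0) => a b /=; rewrite mul1r mul0r subr0.
Qed.

Lemma Re_lin (x : R) (z w : R[i]) :
  complex.Re (x%:C%C * z + w) = x * complex.Re z + complex.Re w.
Proof. by case: z w => [a b] [c d] /=; rewrite mul0r subr0. Qed.

Lemma real_modeD m s (v w : 'cV[R[i]]_m) t :
  real_mode s (v + w) t = real_mode s v t + real_mode s w t.
Proof.
by apply/colP => i; rewrite !mxE mulrDr; case: (_ * v i 0) (_ * w i 0) => [a b] [c d].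
Qed.

Lemma real_mode_mulmx m q s (M : 'M[R]_(q, m)) (v : 'cV[R[i]]_m) t :
  real_mode s (cmx M *m v) t = M *m real_mode s v t.
Proof.
apply/colP => i; rewrite !mxE mulr_sumr.
rewrite (big_morph (@complex.Re R) (id1 := 0) (op1 := +%R))//; last by case=> [? ?] [].
apply: eq_bigr => j _; rewrite !mxE mulrCA -[_ * (_ * _)]addr0 Re_lin /= addr0.
by [].
Qed.

(** The trailing [+ 0] matches the shape [c *: f + g] of [smooth_lin]. *)
Lemma real_mode_entry m s (v : 'cV[R[i]]_m) i :
  (fun t => real_mode s v t i 0) =
    complex.Re (v i 0) *: (fun t => expR (complex.Re s * t) * cos (complex.Im s * t)) +
    (- complex.Im (v i 0) *: (fun t => expR (complex.Re s * t) * sin (complex.Im s * t)) + 0).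
Proof.
apply/funext => t; rewrite mxE addr0 /cexp !fctE /GRing.scale /=.
by case: (v i 0) => a b /=; ring.
Qed.

Lemma real_mode_smooth m s (v : 'cV[R[i]]_m) : smooth_signal (real_mode s v).
Proof.
move=> i; rewrite real_mode_entry.
have [sc ss] := smooth_exp_trig (complex.Re s) (complex.Im s).
exact: smooth_lin sc (smooth_lin ss (@smooth0 R)).
Qed.

Lemma real_mode_derivative m s (v : 'cV[R[i]]_m) t :
  time_derivative (real_mode s v) t = real_mode s (s *: v) t.
Proof.
apply/colP => i; rewrite mxE real_mode_entry addr0.
set a := complex.Re s; set b := complex.Im s.
rewrite (is_derive1E (is_deriveD (is_deriveZ (complex.Re (v i 0)) (is_derive_expcos a b t))
  (is_deriveZ (- complex.Im (v i 0)) (is_derive_expsin a b t)))) {}/a {}/b.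
rewrite !mxE /cexp /GRing.scale /=.
by case: s (v i 0) => a b [c d] /=; ring.
Qed.

Lemma real_mode_spread m (K : {set 'I_m}) s (v : 'cV[R[i]]_#|K|) t :
  real_mode s (spread v) t = spread (real_mode s v t).
Proof.
rewrite /spread -real_mode_mulmx; congr (real_mode s (_ *m v) t).
by apply/matrixP => i j; rewrite !mxE rmorph_nat.
Qed.

(** For [c = 1 + i T] the real part of [c (a + i b)] is [a - T b]. With [T] above every ratio
    [a / b], it vanishes only for [a = b = 0]. *)
Lemma exists_nonimaginary_scaling (I : finType) (g : I -> R[i]) :
  (forall i, g i != 0) -> exists c, forall i, complex.Re (c * g i) != 0.
Proof.
move=> g0; pose r i := complex.Re (g i) / complex.Im (g i).
pose T := 1 + \sum_i `|r i|.
exists (Complex 1 T) => i; have := g0 i.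
have rT : r i < T.
  rewrite /T (bigD1 i) //= addrCA.
  have : 0 <= \sum_(j | j != i) `|r j| by apply: sumr_ge0.
  have := ler_norm (r i); lra.
move: rT; rewrite /r; case: (g i) => a b /= rT; rewrite mul1r; apply: contraNneq => abT.
rewrite eq_complex /=.
have aE : a = T * b by apply/eqP; rewrite -subr_eq0 abT.
have [b0|b0] := eqVneq b 0; first by rewrite aE b0 mulr0 eqxx.
by move: rT; rewrite aE mulfK// ltxx.
Qed.

End RealModes.

Section ModeFlow.
Variables (R : realType) (n p : nat) (E A : 'M[R]_n) (C : 'M[R]_(p, n)).

Lemma zero_modeZ c s z g : zero_mode E A C s z g -> zero_mode E A C s (c *: z) (c *: g).
Proof.
move=> [e1 e2]; split; first by rewrite -scalemxAr e1 linearZ.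
by rewrite -scalemxAr linearZ /= -scalerDr e2 scaler0.
Qed.

Lemma mode_zero_flow s z g : zero_mode E A C s z g ->
  zero_flow E A C (real_mode s g) (real_mode s z).
Proof.
move=> [e1 e2]; split=> t t0.
- by move=> i; apply: smooth_signal_derivable; exact: real_mode_smooth.
- rewrite real_mode_derivative -real_mode_mulmx -scalemxAr.
  have -> : usubmx (real_mode s g t) = real_mode s (usubmx g) t.
    by apply/colP => i; rewrite !mxE.
  rewrite -real_mode_mulmx -real_modeD -e1 mulmxBl -scalemxAl.
  by rewrite addrCA subrr addr0.
- have -> : dsubmx (real_mode s g t) = real_mode s (dsubmx g) t.
    by apply/colP => i; rewrite !mxE.
  rewrite -real_mode_mulmx -real_modeD e2.
  by apply/colP => i; rewrite !mxE mulr0.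
Qed.

End ModeFlow.

(** * Attack sets *)

Lemma exists_subset_card (T : finType) (B : {set T}) k :
  (k <= #|B|)%N -> exists B' : {set T}, B' \subset B /\ #|B'| = k.
Proof.
move=> kB; exists [set x in take k (enum B)]; split.
  by apply/fintype.subsetP => x; rewrite inE => /mem_take; rewrite mem_enum.
rewrite cardsE (card_uniqP _) ?take_uniq ?enum_uniq//.
by rewrite size_takel// -cardE.
Qed.

(** If [T] has at least [k] elements, it is cut into [K] and its complement in [T]. Otherwise [T] is
    padded to a [k]-element set [K], and [S] drops one point of [T]. *)
Lemma exists_two_cover (I : finType) (T : {set I}) k :
  T != finset.set0 -> (#|T| <= 2 * k)%N -> (k <= #|I|)%N ->
  exists K S : {set I}, [/\ #|K| = k, (#|S| <= k)%N, S != K,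
    T \subset K :|: S & forall i, i \notin T -> (i \in K) = (i \in S)].
Proof.
move=> T0 Tk kI; have [kT|Tk'] := leqP k #|T|.
  have [K [KT cK]] := exists_subset_card kT.
  exists K, (T :\: K); split=> //.
  - by rewrite cardsD (finset.setIidPr KT) cK leq_subLR addnn -mul2n.
  - have [j jT] := finset.set0Pn _ T0.
    by apply/eqP => /finset.setP/(_ j); rewrite !inE jT andbT; case: (j \in K).
  - by apply/fintype.subsetP => i iT; rewrite !inE iT andbT orbN.
  - move=> i iT; rewrite inE (negPf iT) andbF; apply/negbTE.
    by apply: contra iT; apply: (fintype.subsetP KT).
have : (k - #|T| <= #|~: T|)%N by rewrite -(leq_add2l #|T|) cardsC subnKC// ltnW.
move=> /exists_subset_card[U [UT cU]].
have TU0 : T :&: U = finset.set0.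
  apply/finset.setP => i; rewrite !inE; apply/andP => -[iT /(fintype.subsetP UT)].
  by rewrite inE iT.
have cK : #|T :|: U| = k by have := cardsUI T U; rewrite TU0 cards0 addn0 cU subnKC// ltnW.
have [j jT] := finset.set0Pn _ T0.
have jK : j \in T :|: U by rewrite inE jT.
exists (T :|: U), ((T :|: U) :\ j); split=> //.
- by have := cardsD1 j (T :|: U); rewrite jK cK => ->; exact: leq_addl.
- by apply/eqP => /finset.setP/(_ j); rewrite setD11 jK.
- by apply: (fintype.subset_trans _ (finset.subsetUl _ _)); exact: finset.subsetUl.
- move=> i iT; have ij : i != j by apply: contraNneq iT => ->.
  by rewrite in_setD1 ij.
Qed.

(** At such an index the attack on [K] cannot be cancelled by the one on [S]. *)
Lemma setD_neq0 (I : finType) (K S : {set I}) :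
  (#|S| <= #|K|)%N -> S != K -> exists i, i \in K /\ i \notin S.
Proof.
move=> SK nSK; have /subsetPn[i iK iS] : ~~ (K \subset S).
  by apply: contra nSK => KS; rewrite eq_sym finset.eqEcard KS SK.
by exists i.
Qed.

(** * Equivalences between unidentifiability, zeroing attacks and pencil conditions *)

Section Attacks.
Variables (R : realType) (n p : nat) (E A : 'M[R]_n) (C : 'M[R]_(p, n)).
Hypothesis regEA : regular_pencil E A.
Implicit Types (K S T : {set 'I_(n + p)}).

Lemma attack_modeN m (S : {set 'I_m}) (u : R -> 'cV[R]_#|S|) :
  attack_mode u -> attack_mode (fun t => - u t).
Proof.
move=> [su nu]; split; first exact: smooth_signalN.
by move=> j; have [t [t0 ut]] := nu j; exists t; rewrite mxE oppr_eq0.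
Qed.

Lemma attack_modeP m (K : {set 'I_m}) (u : R -> 'cV[R]_m) :
  (forall i, i \in K -> smooth (fun t => u t i 0)) ->
  (forall i, i \in K -> exists t, 0 <= t /\ u t i 0 != 0) ->
  attack_mode (fun t => entries_on K (u t)).
Proof.
move=> su nu; split=> [j|j].
  rewrite (_ : (fun t => entries_on K (u t) j 0) = (fun t => u t (enum_val j) 0)).
    by apply: su; exact: enum_valP.
  by apply/funext => t; rewrite mxE.
by have [t [t0 ut]] := nu _ (enum_valP j); exists t; rewrite mxE.
Qed.

Lemma spread_smooth m (K : {set 'I_m}) (u : R -> 'cV[R]_#|K|) :
  smooth_signal u -> smooth_signal (fun t => spread (u t)).
Proof. exact: smooth_signal_mulmx. Qed.

Lemma spread_supp K S (uK : R -> 'cV[R]_#|K|) (uS : R -> 'cV[R]_#|S|) t i :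
  i \notin K :|: S -> (spread (uK t) + spread (uS t)) i 0 = 0.
Proof.
by rewrite inE negb_or => /andP[iK iS]; rewrite mxE !spread_notin ?addr0.
Qed.

Lemma same_output_zeroing K S (uK : R -> 'cV[R]_#|K|) (uS : R -> 'cV[R]_#|S|)
    (x1 x2 : 'cV[R]_n) :
  same_output E A C uK uS x1 x2 ->
  exists x, zeroing_trajectory E A C uK (fun t => - uS t) (x1 - x2) x.
Proof.
move=> /same_output_flow[x [x0 fl]]; exists x; apply/zeroing_trajectoryP; split=> //.
by apply: zero_flow_eq fl => t _; rewrite spreadN.
Qed.

Lemma zeroing_same_output K S (uK : R -> 'cV[R]_#|K|) (uS : R -> 'cV[R]_#|S|)
    (x0 : 'cV[R]_n) x :
  smooth_signal uS -> zeroing_trajectory E A C uK uS x0 x ->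
  exists x1 x2 : 'cV[R]_n, same_output E A C uK (fun t => - uS t) x1 x2 /\ x1 - x2 = x0.
Proof.
move=> suS /zeroing_trajectoryP[<- fl].
apply: flow_same_output => //; first exact: smooth_signalN.
by apply: zero_flow_eq fl => t _; rewrite spreadN opprK.
Qed.

Lemma unidentifiable_zeroing K : unidentifiable_set E A C K <-> zeroing_modes E A C K.
Proof.
split=> [[uK [aK [S [uS [x1 [x2 [SK nSK aS so]]]]]]]|[S [uK [uS [x0 [x [SK nSK aK aS zt]]]]]]].
  have [x zx] := same_output_zeroing so.
  exists S, uK, (fun t => - uS t), (x1 - x2), x; split=> //.
  exact: attack_modeN.
have [x1 [x2 [so _]]] := zeroing_same_output aS.1 zt.
exists uK; split=> //; exists S, (fun t => - uS t), x1, x2; split=> //.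
exact: attack_modeN.
Qed.

Lemma unidentifiable_zeroing_within K :
  unidentifiable_within E A C K <-> zeroing_modes_within E A C K.
Proof.
split=> [[S [uK [uS [x1 [x2 [SK aK aS x12 so]]]]]]|[S [uK [uS [x0 [x [SK aK aS x00 zt]]]]]]].
  have [x zx] := same_output_zeroing so.
  exists S, uK, (fun t => - uS t), (x1 - x2), x; split=> //.
    exact: smooth_signalN.
  by rewrite subr_eq0.
have [x1 [x2 [so x12]]] := zeroing_same_output aS zt.
exists S, uK, (fun t => - uS t), x1, x2; split=> //.
  exact: smooth_signalN.
by rewrite -subr_eq0 x12.
Qed.

(** A trajectory that is zero for all [t >= 0] would force a zero input, yet at an index of [K]
    outside [S] the input is a nonzero entry of [uK]. So some position is nonzero, and it yields an
    eigenmode. *)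
Lemma zeroing_pencil K : zeroing_modes E A C K -> pencil_condition E A C K.
Proof.
move=> [S [uK [uS [x0 [x [SK nSK [_ aK] _ /zeroing_trajectoryP[_ fl]]]]]]].
have [i [iK iS]] := setD_neq0 SK nSK.
have [t [t0 xt]] : exists t, 0 <= t /\ x t != 0.
  apply: contrapT => xz.
  have xz0 t : 0 <= t -> x t = 0.
    by move=> t0; apply/eqP/negP => /negP xt; apply: xz; exists t.
  have [t [t0 ut]] := aK (enum_rank_in iK i).
  have /colP/(_ i) := zero_flow_input_eq0 fl xz0 t0.
  by rewrite [RHS]mxE mxE (spread_notin _ iS) addr0 spread_in => u0; rewrite u0 eqxx in ut.
by apply: flow_pencil_condition SK nSK fl _ t0 xt => u _ j; exact: spread_supp.
Qed.

(** The factor [c] stays free so that real parts can be kept from vanishing at time 0. *)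
Lemma mode_zeroing K S s (gK : 'cV[R[i]]_#|K|) (gS : 'cV[R[i]]_#|S|) z c :
  invariant_zero E A C s gK gS z ->
  exists x, zeroing_trajectory E A C (real_mode s (c *: gK)) (real_mode s (c *: gS))
    (real_mode s (c *: z) 0) x.
Proof.
move=> /invariant_zeroP[z0 mode].
exists (real_mode s (c *: z)); apply/zeroing_trajectoryP; split=> //.
apply: zero_flow_eq (mode_zero_flow (zero_modeZ c mode)) => t _.
by rewrite -!real_mode_spread -real_modeD /spread -!scalemxAr -scalerDr.
Qed.

Lemma pencil_zeroing_within K : pencil_condition E A C K -> zeroing_modes_within E A C K.
Proof.
move=> [S [s [gK [gS [z [SK nSK inv]]]]]].
have [z0 _ _] := inv; have [i zi] : exists i, z i 0 != 0.
  apply/existsP; apply: contraR z0; rewrite negb_exists => /forallP zz.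
  by apply/eqP/colP => i; rewrite mxE; apply/eqP; have := zz i; rewrite negbK.
(* One nonzero entry of [z] is enough to make the real initial state nonzero, whence the one-element
   index type. *)
have [c cz] := @exists_nonimaginary_scaling R unit (fun=> z i 0) (fun=> zi).
have [x zx] := mode_zeroing c inv.
exists S, (real_mode s (c *: gK)), (real_mode s (c *: gS)), (real_mode s (c *: z) 0), x.
split=> //; try exact: real_mode_smooth.
by apply: contraNneq (cz tt) => /colP/(_ i); rewrite real_mode0 !mxE => ->.
Qed.

Lemma zeroing_within_pencil K : zeroing_modes_within E A C K -> pencil_condition E A C K.
Proof.
move=> [S [uK [uS [x0 [x [[SK nSK] _ _ x00 /zeroing_trajectoryP[x0E fl]]]]]]].
rewrite -x0E in x00.
by apply: flow_pencil_condition SK nSK fl _ (lexx 0) x00 => u _ j; exact: spread_supp.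
Qed.

Lemma pencil_full_unidentifiable K :
  pencil_condition_full E A C K -> unidentifiable_set E A C K.
Proof.
move=> [S [s [gK [gS [z [[SK nSK] gK0 gS0 inv]]]]]].
(* The sum type makes one scaling [c] serve all entries of both directions. *)
pose g (j : 'I_#|K| + 'I_#|S|) := match j with inl j => gK j 0 | inr j => gS j 0 end.
have [c cg] := @exists_nonimaginary_scaling R _ g
  (fun j => match j with inl j => gK0 j | inr j => gS0 j end).
have [x zx] := mode_zeroing c inv.
apply/unidentifiable_zeroing.
exists S, (real_mode s (c *: gK)), (real_mode s (c *: gS)), (real_mode s (c *: z) 0), x.
split=> //; split=> [|j]; try exact: real_mode_smooth.
  by exists 0; rewrite lexx real_mode0 mxE; split=> //; exact: (cg (inl j)).
by exists 0; rewrite lexx real_mode0 mxE; split=> //; exact: (cg (inr j)).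
Qed.

Lemma zeroing_undetectable K : zeroing_modes E A C K ->
  exists T, [/\ T != finset.set0, (#|T| <= 2 * #|K|)%N & undetectable_set E A C T].
Proof.
move=> [S [uK [uS [x0 [x [SK nSK aK aS /zeroing_trajectoryP[_ fl]]]]]]].
pose u t := spread (uK t) + spread (uS t).
(* The exact support of the combined attack on [t >= 0]: the two modes may cancel on the overlap,
   and an attack mode must be nonzero at every index of its set. *)
pose T : {set 'I_(n + p)} := [set i | `[< exists t, 0 <= t /\ u t i 0 != 0 >]]%SET.
have TE i : i \notin T -> forall t, 0 <= t -> u t i 0 = 0.
  rewrite inE => /asboolPn iT t t0; apply/eqP/negP => /negP ut.
  by apply: iT; exists t.
exists T; split.
- have [i [iK iS]] := setD_neq0 SK nSK.
  apply/finset.set0Pn; exists i; rewrite inE; apply/asboolP.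
  have [t [t0 ut]] := aK.2 (enum_rank_in iK i); exists t; split=> //.
  by rewrite mxE (spread_notin _ iS) addr0 spread_in.
- apply: leq_trans (_ : #|K :|: S| <= _)%N.
    apply/subset_leq_card/fintype.subsetP => i; apply: contraLR => iKS.
    rewrite inE; apply/asboolPn => -[t [_]]; rewrite /u.
    by rewrite spread_supp ?eqxx.
  by rewrite (leq_trans (leq_card_setU _ _))// mul2n -addnn leq_add2l.
exists (fun t => entries_on T (u t)); split.
  apply: attack_modeP => i; last by rewrite inE => /asboolP.
  by move=> _; apply: (smooth_signalD (spread_smooth aK.1) (spread_smooth aS.1)).
have s0 : smooth_signal (fun=> 0 : 'cV[R]_#|finset.set0 : {set 'I_(n + p)}|).
  by move=> i; rewrite (_ : (fun=> _) = (fun=> 0));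
    [exact: smooth_cst|apply/funext => t; rewrite mxE].
have [|x1 [x2 [so _]]] := flow_same_output
  (uK := fun t => entries_on T (u t)) (x := x) (C := C) regEA s0.
  apply: zero_flow_eq fl => t t0.
  by rewrite spread0 subr0 spread_entries_on// => i iT; exact: TE.
by exists x1, x2.
Qed.

(** The attack [w] on [T] is written as [v] on [K] plus [w - v] on [S]. An index in only one of the
    two sets lies in [T] and keeps its entry of [w]; an index of both outside [T] carries opposite
    nonzero constants. *)
Lemma undetectable_zeroing T k : T != finset.set0 -> (#|T| <= 2 * k)%N -> (k <= n + p)%N ->
  undetectable_set E A C T -> exists K, #|K| = k /\ zeroing_modes E A C K.
Proof.
move=> T0 Tk kn [u [[su nu] [x1 [x2 /same_output_flow[x [_ fl]]]]]].
have [|K [S [cK cS nSK TKS KS]]] := exists_two_cover T0 Tk; first by rewrite card_ord.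
pose w t : 'cV[R]_(n + p) := spread (u t).
(* On [K :&: S] the entry is split as [d i + (w i - d i)], with the constant
   [d i] chosen so that neither part vanishes at time 0. *)
pose d i : R := `|w 0 i 0| + 1.
pose v t : 'cV[R]_(n + p) := \col_i (if i \in K then if i \in S then d i else w t i 0 else 0).
have d0 i : d i != 0 by rewrite gt_eqF// ltr_wpDl.
have dw i : w 0 i 0 - d i != 0.
  by rewrite lt_eqF// subr_lt0 /d (le_lt_trans (ler_norm _))// ltrDl.
have sw : smooth_signal w by exact: spread_smooth.
have nw i : i \in T -> exists t, 0 <= t /\ w t i 0 != 0.
  move=> iT; have [t [t0 ut]] := nu (enum_rank_in iT i).
  by exists t; rewrite /w spread_in.
have ndS i : i \in K -> i \notin S -> i \in T.
  by move=> iK; apply: contraR => /KS <-.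
have ndK i : i \in S -> i \notin K -> i \in T.
  by move=> iS; apply: contraR => /KS ->.
have aK : attack_mode (fun t => entries_on K (v t)).
  apply: attack_modeP => i iK; have [iS|iS] := boolP (i \in S).
  - rewrite (_ : (fun t => _) = (fun=> d i)); first exact: smooth_cst.
    by apply/funext => t; rewrite mxE iK iS.
  - rewrite (_ : (fun t => _) = (fun t => w t i 0)); first exact: sw.
    by apply/funext => t; rewrite mxE iK (negPf iS).
  - by exists 0; rewrite lexx mxE iK iS.
  - have [t [t0 wt]] := nw i (ndS i iK iS); exists t.
    by rewrite mxE iK (negPf iS).
have vE t i : v t i 0 = if i \in K then if i \in S then d i else w t i 0 else 0 by rewrite mxE.
have wvE t i : (w t - v t) i 0 = w t i 0 - v t i 0 by rewrite mxE [X in _ + X]mxE.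
have aS : attack_mode (fun t => entries_on S (w t - v t)).
  apply: attack_modeP => i iS; have [iK|iK] := boolP (i \in K).
  - rewrite (_ : (fun t => _) = 1 *: (fun t => w t i 0) + (fun=> - d i)).
      by have := @smooth_lin R 1 _ (fun=> - d i) (sw i) (@smooth_cst R (- d i)).
    by apply/funext => t; rewrite scale1r wvE vE iK iS.
  - rewrite (_ : (fun t => _) = (fun t => w t i 0)); first exact: sw.
    by apply/funext => t; rewrite wvE vE (negPf iK) subr0.
  - by exists 0; rewrite lexx wvE vE iK iS.
  - have [t [t0 wt]] := nw i (ndK i iS iK); exists t.
    by rewrite wvE vE (negPf iK) subr0.
exists K; split=> //.
exists S, (fun t => entries_on K (v t)), (fun t => entries_on S (w t - v t)), (x 0), x.
split=> //; first by rewrite cK.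
apply/zeroing_trajectoryP; split=> //; apply: zero_flow_eq fl => t t0.
rewrite spread0 subr0 !spread_entries_on => [||i iK].
- by rewrite addrC subrK.
- move=> i iS; rewrite wvE vE (negPf iS).
  case: ifP => [_|/negbT iK]; first by rewrite subrr.
  rewrite subr0 /w spread_notin//; apply: contra iK => /(fintype.subsetP TKS).
  by rewrite inE (negPf iS) orbF.
- by rewrite mxE (negPf iK).
Qed.

End Attacks.

Theorem mainTheorem4 (R : realType) (n p : nat) (E A : 'M[R]_n)
    (C : 'M[R]_(p, n)) (regEA : regular_pencil E A) :
  (forall K : {set 'I_(n + p)},
     [/\ unidentifiable_set E A C K <-> zeroing_modes E A C K,
         zeroing_modes E A C K -> pencil_condition E A C K,
         pencil_condition_full E A C K -> unidentifiable_set E A C K,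
         unidentifiable_within E A C K <-> zeroing_modes_within E A C K
       & zeroing_modes_within E A C K <-> pencil_condition E A C K]) /\
  (forall k : nat, (k <= n + p)%N ->
     (exists K : {set 'I_(n + p)}, #|K| = k /\ unidentifiable_set E A C K) <->
     (exists Kbar : {set 'I_(n + p)},
        [/\ Kbar != finset.set0, (#|Kbar| <= 2 * k)%N
          & undetectable_set E A C Kbar])).
Proof.
split=> [K|k kn].
  split; first exact: unidentifiable_zeroing.
  - exact: zeroing_pencil.
  - exact: pencil_full_unidentifiable.
  - exact: unidentifiable_zeroing_within.
  - by split; [exact: zeroing_within_pencil|exact: pencil_zeroing_within].
split=> [[K [<- uK]]|[T [T0 Tk uT]]].
  by apply: (zeroing_undetectable regEA); apply/(unidentifiable_zeroing C regEA).
have [K [cK zK]] := undetectable_zeroing T0 Tk kn uT.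
by exists K; split=> //; apply/(unidentifiable_zeroing C regEA).
Qed.
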